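(* For each odd integer $d > 2$, the explicitly constructed polynomial $s_d$ (defined in the context) has rational coefficients and degree at most $d$, and the Hénon map $$h_d(x,y) = (y,\, -x + s_d(y))$$ has at least $(d-4)^2$ rational periodic points, i.e. there are at least $(d-4)^2$ points $P \in \mathbb{Q}^2$ such that $h_d^{\circ n}(P) = P$ for some integer $n \geq 1$.
   Context: For each integer $j \ge 0$ let $$c_{2j+1}(x) := \frac{1}{(2j+1)!}\, x\prod_{i=1}^{j}(x^2-i^2),$$ with empty products equal to $1$. For odd $d = 2k+1$ with $k \geq 0$ define $$s_{d}(x) = s_{2k+1}(x) := \sum_{j=0}^{k}(-1)^{k-j}c_{2j+1}(x) \in \mathbb{Q}[x].$$ Here $h_d^{\circ n}$ denotes the $n$-fold composition of $h_d$ with itself. *)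

(* Defs.v *)
From mathcomp Require Import all_boot all_order all_algebra.

Set Implicit Arguments.
Unset Strict Implicit.
Unset Printing Implicit Defensive.

Import GRing.Theory.
Local Open Scope ring_scope.

(* [c_odd j] is the polynomial c_{2j+1}. *)
Definition c_odd (j : nat) : {poly rat} :=
  ((j.*2.+1)`!%:R)^-1 *:
    ('X * \prod_(1 <= i < j.+1) ('X^2 - (i%:R ^+ 2)%:P)).

(* Meaningful for odd [d = 2k+1] only, in which case [d./2 = k]. *)
Definition s_poly (d : nat) : {poly rat} :=
  \sum_(0 <= j < (d./2).+1) (-1) ^+ (d./2 - j) *: c_odd j.

Definition henon (f : {poly rat}) (P : rat * rat) : rat * rat :=
  (P.2, - P.1 + f.[P.2]).

Definition periodic (T : Type) (h : T -> T) (P : T) : Prop :=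
  exists2 n : nat, (1 <= n)%N & iter n h P = P.

(* Main.v *)
(* Since c_{2j+1}(x) = binom(x + j, 2j + 1), its second central difference is
   c_{2j-1}, whence  s_d(x + 1) + s_d(x - 1) = s_d(x) + c_d(x)  for d = 2k + 1.
   As c_d vanishes at the integers of absolute value at most k, on the integers
   y with |y| <= k + 1 the values s_d(y) follow the 6-periodic sequence
   0, 1, 1, 0, -1, -1, up to the sign (-1)^k, and at y = k + 2 there is a
   correction by c_d(k + 1) = 1.

   The Henon map is a bijection, so a point is periodic as soon as its orbit
   stays in a finite set. After exchanging the coordinates the map fixes y and
   replaces x by s_d(y) - x, so it preserves every symmetric relation E each of
   whose slices {x | E x y} is stable under the reflection x |-> s_d(y) - x.
   Such a finite E containing all |x|, |y| <= k - 2 is given by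
   "x in I_y and y in I_x", where I_y is an integer interval whose endpoints
   depend on y modulo 6 only; it is chosen according to k modulo 3. *)
Require Import Defs.
From mathcomp Require Import all_boot all_order all_algebra.
From mathcomp Require Import zify ring lra.
Local Open Scope ring_scope.
Import GRing.Theory Num.Theory Order.TTheory.

(** * Periodicity from confinement to a finite set *)

Lemma injective_confined_periodic (T : eqType) (h : T -> T) (P : T)
    (s : seq T) :
  injective h -> (forall n, iter n h P \in s) -> periodic h P.
Proof.
move=> inj_h in_s.
have loop : looping h P (size s).
  apply: contraT; rewrite -looping_uniq => uniq_orbit.
  have sub : {subset traject h P (size s).+1 <= s}.
    by move=> _ /trajectP[i _ ->]; apply: in_s.
  by have := uniq_leq_size uniq_orbit sub; rewrite size_traject ltnn.
have /trajectP[i lt_is] := loop; set n := size s in lt_is *.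
(* The orbit comes back to its iterate of index [i]; injectivity cancels these [i] applications. *)
rewrite -(subnKC (ltnW lt_is)) iterD => eq_P.
exists (n - i)%N; first by rewrite subn_gt0.
by elim: i (n - i)%N eq_P {lt_is} => //= i IH m /inj_h /IH.
Qed.

Lemma henon_inj (f : {poly rat}) : injective (henon f).
Proof. by move=> [x y] [x' y'] [] <- /addIr /oppr_inj <-. Qed.

Lemma symmetric_trap_periodic (f : {poly rat}) (E : rel int) (K : int) :
    symmetric E -> (forall x y, E x y -> `|x| <= K) ->
    (forall x y, E x y ->
       exists2 x' : int, f.[y%:~R] = (x + x')%:~R & E x' y) ->
  forall x y, E x y -> periodic (henon f) (x%:~R, y%:~R).
Proof.
move=> symE bndE stepE x y Exy.
pose r := [seq (i%:Z - K)%:~R : rat | i <- iota 0 (absz (2 * K + 1))].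
have in_r (z : int) : `|z| <= K -> z%:~R \in r.
  move=> zK; apply/mapP; exists (absz (z + K)); first by rewrite mem_iota; lia.
  by congr (_%:~R); lia.
apply: (injective_confined_periodic _ _ _ [seq (a, b) | a <- r, b <- r]).
  exact: henon_inj.
move=> n.
have [a [b [-> Eab]]] : exists a b : int,
    iter n (henon f) (x%:~R, y%:~R) = (a%:~R, b%:~R) /\ E a b.
  elim: n => [|n [a [b [IH Eab]]]]; first by exists x, y.
  have [a' fb Ea'b] := stepE _ _ Eab.
  exists b, a'; split; last by rewrite symE.
  by rewrite iterS IH /henon /= fb rmorphD /= addKr.
apply/allpairsP; exists (a%:~R, b%:~R); split => //=; apply: in_r.
  exact: bndE Eab.
by apply: (bndE b a); rewrite symE.
Qed.

(** * Difference identities for the polynomials c and s *)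

Lemma horner_c_odd j (x : rat) :
  (c_odd j).[x] =
  ((j.*2.+1)`!%:R)^-1 * (x * \prod_(1 <= i < j.+1) (x ^+ 2 - i%:R ^+ 2)).
Proof.
rewrite /c_odd hornerZ hornerM hornerX horner_prod.
by congr (_ * (_ * _)); apply: eq_bigr => i _; rewrite !hornerE.
Qed.

Lemma c_oddS j (x : rat) :
  (c_odd j.+1).[x] =
  (c_odd j).[x] * (x ^+ 2 - j.+1%:R ^+ 2) / (j.*2.+2%:R * j.*2.+3%:R).
Proof.
rewrite !horner_c_odd big_nat_recr //= doubleS !factS !natrM.
have := fact_gt0 j.*2; rewrite -(ltr0n rat) => /lt0r_neq0 h.
by field; rewrite h -!natrD nat1r !pnatr_eq0.
Qed.

Lemma c_oddN j (x : rat) : (c_odd j).[- x] = - (c_odd j).[x].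
Proof. by rewrite !horner_c_odd sqrrN mulNr mulrN. Qed.

Lemma c_odd0 (x : rat) : (c_odd 0).[x] = x.
Proof. by rewrite horner_c_odd big_geq // mulr1 invr1 mul1r. Qed.

(** The binomial at x + 1 has the factors x - j, ..., x + j + 2: those of [c_odd j] at x and two
    more. So all terms of the second difference share the factor [(c_odd j).[x]]. *)
Lemma c_odd_succ j (x : rat) :
  (c_odd j.+1).[x + 1] =
  (c_odd j).[x] * (x + j.+1%:R) * (x + j.+2%:R) / (j.*2.+2%:R * j.*2.+3%:R).
Proof.
have nz i : i.+1%:R != 0 :> rat by rewrite pnatr_eq0.
elim: j => [|j IH]; first by rewrite c_oddS !c_odd0; field.
rewrite c_oddS IH c_oddS !doubleS.
field.
by rewrite -!natrD ?nat1r !pnatr_eq0.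
Qed.

Lemma c_odd_pred j (x : rat) :
  (c_odd j.+1).[x - 1] =
  (c_odd j).[x] * (x - j.+1%:R) * (x - j.+2%:R) / (j.*2.+2%:R * j.*2.+3%:R).
Proof.
by rewrite -[x - 1]opprK opprB addrC c_oddN c_odd_succ c_oddN; ring.
Qed.

Lemma c_odd_diff2 j (x : rat) :
  (c_odd j.+1).[x + 1] + (c_odd j.+1).[x - 1] =
  2 * (c_odd j.+1).[x] + (c_odd j).[x].
Proof.
rewrite c_odd_succ c_odd_pred c_oddS -mul2n; field.
by rewrite -!natrM -!natrD ?nat1r !pnatr_eq0.
Qed.

Lemma c_odd_small j n : (n <= j)%N -> (c_odd j).[n%:R] = 0.
Proof.
elim: j => [|j IH]; first by rewrite leqn0 c_odd0 => /eqP ->.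
rewrite leq_eqVlt ltnS c_oddS => /predU1P[->|/IH ->]; last by rewrite !mul0r.
by rewrite subrr mulr0 mul0r.
Qed.

Lemma c_odd_top j : (c_odd j).[j.+1%:R] = 1.
Proof.
elim: j => [|j IH]; first by rewrite c_odd0.
rewrite -natr1 c_odd_succ IH mul1r -!natrD addnn addnS addnn doubleS divff //.
by rewrite mulf_neq0 // pnatr_eq0.
Qed.

Lemma s_poly0 (x : rat) : (s_poly 1).[x] = x.
Proof. by rewrite /s_poly big_nat1 hornerZ c_odd0 mul1r. Qed.

Lemma s_polyS k (x : rat) :
  (s_poly k.+1.*2.+1).[x] = (c_odd k.+1).[x] - (s_poly k.*2.+1).[x].
Proof.
rewrite /s_poly !(half_bit_double _ true) big_nat_recr //= subnn scale1r.
rewrite hornerD.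
rewrite addrC; congr (_ + _); rewrite -hornerN -sumrN; congr (_.[x]).
apply: eq_big_nat => j /andP[_ jk].
by rewrite subSn // exprS mulN1r scaleNr.
Qed.

Lemma s_polyN k (x : rat) :
  (s_poly k.*2.+1).[- x] = - (s_poly k.*2.+1).[x].
Proof.
elim: k => [|k IH]; first by rewrite !s_poly0.
by rewrite !s_polyS c_oddN IH opprB addrC opprK.
Qed.

(** By induction: the [c_odd k] produced by the second difference of [c_odd k.+1] cancels the error
    term of the previous stage. *)
Lemma s_poly_rec k (x : rat) :
  (s_poly k.*2.+1).[x + 1] + (s_poly k.*2.+1).[x - 1] =
  (s_poly k.*2.+1).[x] + (c_odd k).[x].
Proof.
elim: k => [|k IH]; first by rewrite !s_poly0 c_odd0; ring.
by have := c_odd_diff2 k x; rewrite !s_polyS; lra.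
Qed.

Lemma size_s_poly k : (size (s_poly k.*2.+1) <= k.*2.+2)%N.
Proof.
rewrite /s_poly (half_bit_double _ true).
apply: (leq_trans (size_sum _ _ _)); apply/bigmax_leqP_seq => j.
rewrite mem_index_iota ltnS => /= jk _.
rewrite (leq_trans (size_scale_leq _ _)) // (leq_trans (size_scale_leq _ _)) //.
apply: (@leq_trans j.*2.+2); last by rewrite !ltnS leq_double.
rewrite (leq_trans (size_polyMleq _ _)) // size_polyX.
rewrite add2n ltnS big_add1 big_mkord /=.
rewrite (leq_trans (size_poly_prod_leq _ _)) //.
rewrite leq_subLR card_ord addnC.
rewrite (eq_bigr (fun _ => 3)) => [|i _]; last by rewrite size_XnsubC.
by rewrite sum_nat_const card_ord; lia.
Qed.

(** * Values of s at integers *)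

Definition hexagon (n : int) : int :=
  if (n %% 6)%Z \in [:: 1; 2] then 1
  else if (n %% 6)%Z \in [:: 4; 5] then -1 else 0.

Lemma hexagonP n : let r := (n %% 6)%Z in
  (r = 0 \/ r = 3) /\ hexagon n = 0 \/
  (r = 1 \/ r = 2) /\ hexagon n = 1 \/
  (r = 4 \/ r = 5) /\ hexagon n = -1.
Proof.
have : (0 <= (n %% 6)%Z < 6) by lia.
rewrite /hexagon !inE /=; move: (n %% 6)%Z => r r6.
have : r = 0 \/ r = 1 \/ r = 2 \/ r = 3 \/ r = 4 \/ r = 5 by lia.
by do ![case] => ->; tauto.
Qed.

Lemma hexagonN n : hexagon (- n) = - hexagon n.
Proof. by have := hexagonP n; have := hexagonP (- n) => /=; lia. Qed.

Lemma hexagonD3 n : hexagon (n + 3) = - hexagon n.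
Proof. by have := hexagonP n; have := hexagonP (n + 3) => /=; lia. Qed.

(** The roots of t^2 - t + 1 are the primitive sixth roots of unity, which explains the period 6. *)
Lemma hexagon_rec n : hexagon (n + 1) + hexagon (n - 1) = hexagon n.
Proof.
by have := hexagonP n; have := hexagonP (n + 1); have := hexagonP (n - 1) => /=;
   lia.
Qed.

Lemma norm_hexagon n : -1 <= hexagon n <= 1.
Proof. by have := hexagonP n => /=; lia. Qed.

Lemma hexagon_mul3 (n : nat) : hexagon (3 * n%:Z) = 0.
Proof. have := hexagonP (3 * n%:Z) => /=; lia. Qed.

(* 3 * k shifts [hexagon] by half a period when k is odd, which encodes the
   sign (-1)^k. *)
Definition wave (k y : int) : int := hexagon (y + 3 * k).

Lemma waveN k y : wave k (- y) = - wave k y.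
Proof.
rewrite /wave -hexagonN /hexagon.
by have -> : ((- y + 3 * k) %% 6)%Z = ((- (y + 3 * k)) %% 6)%Z by lia.
Qed.

(** Two consecutive values are carried along because the recurrence has order two; its error term
    vanishes up to k. *)
Lemma s_poly_nat k n : (n <= k)%N ->
  (s_poly k.*2.+1).[n%:R] = (wave k n)%:~R /\
  (s_poly k.*2.+1).[n.+1%:R] = (wave k n.+1)%:~R.
Proof.
rewrite /wave; elim: n => [_|n IH nk].
  have := s_polyN k 0; rewrite oppr0 add0r hexagon_mul3 => s0.
  split; first by lra.
  (* At 1 the term [c_odd k.+1] vanishes, so raising k only flips the sign. *)
  elim: k {s0} => [|k IH]; first by rewrite s_poly0.
  rewrite s_polyS (c_odd_small _ 1) // IH sub0r -rmorphN /= -hexagonD3.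
  by congr (hexagon _)%:~R; lia.
have [IH1 IH2] := IH (ltnW nk); split => //.
have := s_poly_rec k n.+1%:R.
rewrite c_odd_small // addr0 natr1 -[n.+1%:R - 1]/(n.+1%:R - 1%:R) -natrB //.
rewrite subn1 IH1 IH2.
have /(congr1 (fun m : int => m%:~R : rat)) := hexagon_rec (n.+1%:Z + 3 * k%:Z).
rewrite rmorphD /=.
have -> : n.+1%:Z + 3 * k%:Z + 1 = n.+2%:Z + 3 * k%:Z by lia.
have -> : n.+1%:Z + 3 * k%:Z - 1 = n%:Z + 3 * k%:Z by lia.
by lra.
Qed.

Lemma s_poly_int k (y : int) : `|y| <= k.+1%:Z ->
  (s_poly k.*2.+1).[y%:~R] = (wave k y)%:~R.
Proof.
have wave_nat n : (n <= k.+1)%N -> (s_poly k.*2.+1).[n%:R] = (wave k n)%:~R.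
  rewrite leq_eqVlt ltnS => /predU1P[->|]; first by case: (s_poly_nat k k).
  by case/s_poly_nat.
case: (intP y) => [|n|n] yk; first exact: (wave_nat 0).
  by apply: (wave_nat n.+1); lia.
rewrite rmorphN s_polyN (wave_nat n.+1) -?rmorphN; last by lia.
by rewrite waveN.
Qed.

Lemma s_poly_over k :
  (s_poly k.*2.+1).[k.+2%:R] = (wave k k.+2 + 1)%:~R.
Proof.
have := s_poly_rec k k.+1%:R.
rewrite c_odd_top natr1 -[k.+1%:R - 1]/(k.+1%:R - 1%:R) -natrB // subn1.
have [-> ->] := s_poly_nat k k (leqnn k).
have /(congr1 (fun m : int => m%:~R : rat)) := hexagon_rec (k.+1%:Z + 3 * k%:Z).
rewrite /wave !rmorphD /=.
have -> : k.+1%:Z + 3 * k%:Z + 1 = k.+2%:Z + 3 * k%:Z by lia.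
have -> : k.+1%:Z + 3 * k%:Z - 1 = k%:Z + 3 * k%:Z by lia.
by lra.
Qed.

(** * Finite invariant relations *)

(** If |y| < c, then y lies in the interval of every x. Up to sign only the heights c and c + 1
    remain; both have wave value [a], so the reflection there is x |-> a - x, which preserves the
    upper ends of the intervals. *)
Lemma periodic_box_of_plateau k (c a : int) (x y : int) :
    `|a| = 1 -> 0 <= c -> c + 1 <= k.+1%:Z ->
    wave k c = a -> wave k (c + 1) = a ->
    `|x| <= c - 1 -> `|y| <= c - 1 ->
  periodic (henon (s_poly k.*2.+1)) (x%:~R, y%:~R).
Proof.
move=> a1 c0 ck wc wc1 xc yc.
(* The interval of admissible x has midpoint [wave k y / 2] because
   wave (y + a) + wave (y - a) = wave y. *)
pose I (x y : int) :=
  (x <= c + wave k (y + a)) && (- x <= c + wave k (- y + a)).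
have bnd (z : int) : -1 <= wave k z <= 1 by apply: norm_hexagon.
have wave3 (z : int) : wave k (z + 3) = - wave k z.
  by rewrite /wave addrAC hexagonD3.
have wave_rec (z : int) : wave k (z + 1) + wave k (z - 1) = wave k z.
  by rewrite /wave -[RHS]hexagon_rec; congr (hexagon _ + hexagon _); lia.
apply: (@symmetric_trap_periodic _ (fun x y => I x y && I y x) (c + 1)).
- by move=> u v; rewrite andbC.
- by move=> u v /andP[/andP[]]; have := bnd (v + a); have := bnd (- v + a); lia.
- move=> u v /andP[/andP[uv1 uv2] /andP[vu1 vu2]].
  exists (wave k v - u).
    rewrite addrC subrK s_poly_int //.
    by have := bnd (u + a); have := bnd (- u + a); lia.
  have reca : wave k (v + a) - wave k (- v + a) = wave k v.
    rewrite -(wave_rec v) -waveN.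
    have [->|->] : a = 1 \/ a = -1 by lia.
      by congr (_ + wave k _); lia.
    by rewrite addrC; congr (wave k _ + wave k _); lia.
  (* The two arguments add up to 3a, half a period up to sign, and [wave] is odd. *)
  have refl (z : int) : wave k (a - z + a) = wave k (z + a).
    apply: oppr_inj; rewrite -waveN.
    have [->|->] : a = 1 \/ a = -1 by lia.
      have -> : z + 1 = (z - 2) + 3 by lia.
      by rewrite wave3 opprK; congr (wave k _); lia.
    by rewrite -wave3; congr (wave k _); lia.
  (* The bound on p depends on q only when p is c or c + 1. *)
  have mirror p q : p <= c + wave k (q + a) ->
      p <= c + wave k (wave k p - q + a).
    have := bnd (q + a); have := bnd (wave k p - q + a).
    have [pc|pc|->] := ltgtP p c; [by lia| |by rewrite wc refl].
    move=> _ qa pq; have pE : p = c + 1 by lia.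
    by move: pq; rewrite pE wc1 refl.
  have v'u : - v <= c + wave k (- (wave k v - u) + a).
    by have := mirror _ _ vu2; rewrite waveN !opprK opprB [u - _]addrC.
  by rewrite /I (mirror _ _ vu1) v'u; lia.
have := bnd (x + a); have := bnd (- x + a).
by have := bnd (y + a); have := bnd (- y + a); rewrite /I; lia.
Qed.

(** Here the last plateau in the range of [s_poly_int] is at k - 2 and k - 1, one step too low. The
    intervals therefore extend to k + 2, where s takes the value 2 instead of 1. *)
Lemma periodic_box_mod3_0 k (x y : int) :
    (k %% 3)%N = 0%N -> `|x| <= k.+1%:Z -> `|y| <= k.+1%:Z ->
  periodic (henon (s_poly k.*2.+1)) (x%:~R, y%:~R).
Proof.
move=> k3 xk yk.
pose w (z : int) : int := if ((z + 3 * k) %% 6)%Z <= 2 then 1 else 0.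
pose I (x y : int) := (x <= k.+1%:Z + w y) && (- x <= k.+1%:Z + w (- y)).
have bnd (z : int) : 0 <= w z <= 1 by rewrite /w; case: ifP.
have diffw (z : int) : w z - w (- z) = wave k z.
  rewrite /wave /w; have /= := hexagonP (z + 3 * k).
  have : ((z + 3 * k) %% 6)%Z + ((- z + 3 * k) %% 6)%Z \in [:: 0; 6 : int].
    by rewrite !inE; lia.
  have : 0 <= ((- z + 3 * k) %% 6)%Z < 6 by lia.
  move: ((z + 3 * k) %% 6)%Z ((- z + 3 * k) %% 6)%Z (hexagon _) => r r' h.
  by rewrite !inE; do 2?case: ifP; lia.
have refl (z : int) : w (2 - z) = w z by rewrite /w; do 2!case: ifP; lia.
have wtop : w k.+2 = 1 by rewrite /w; do ?case: ifP; lia.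
have wtop' : w (- k.+2%:Z) = 0 by rewrite /w; do ?case: ifP; lia.
have wedge : w (- k.+1%:Z) = 0 by rewrite /w; do ?case: ifP; lia.
clearbody w.
pose E x y := I x y && I y x.
have EN u v : E (- u) (- v) = E u v.
  by rewrite /E /I !opprK; congr andb; rewrite andbC.
have step u v : E u v -> v != - k.+2%:Z ->
    exists2 u', (s_poly k.*2.+1).[v%:~R] = (u + u')%:~R & E u' v.
  move=> /andP[/andP[uv1 uv2] /andP[vu1 vu2]] vmin.
  have [vE|vmax] := eqVneq v k.+2%:Z.
    rewrite vE in uv1 uv2 vu1 vu2 *.
    exists (2 - u : int).
      rewrite addrC subrK s_poly_over; congr (_%:~R).
      by rewrite -diffw wtop wtop'.
    (* That k + 2 lies in the interval of u excludes u = -(k + 1), the only point of the interval of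
       k + 2 that u |-> 2 - u would send outside. *)
    have wu : w u = 1 by have := bnd u; lia.
    have umin : u <> - k.+1%:Z by move=> uE; rewrite uE wedge in wu.
    rewrite /E /I refl wtop wtop' wu.
    rewrite wtop in uv1; rewrite wtop' in uv2.
    have -> : 2 - u <= k.+1%:Z + 1 by lia.
    have -> : - (2 - u) <= k.+1%:Z + 0 by lia.
    have -> : - k.+2%:Z <= k.+1%:Z + w (- (2 - u)).
      by have := bnd (- (2 - u)); lia.
    by rewrite andbT; lia.
  (* Now |v| <= k + 1, so v lies in every interval; only the interval of v matters, and its midpoint
     is wave k v / 2. *)
  exists (wave k v - u).
    by rewrite addrC subrK s_poly_int //; have := bnd u; have := bnd (- u); lia.
  rewrite /E /I -diffw; have := bnd (w v - w (- v) - u).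
  by have := bnd (- (w v - w (- v) - u)); have := bnd u; have := bnd (- u); lia.
apply: (@symmetric_trap_periodic _ E k.+2).
- by move=> u v; rewrite /E andbC.
- by move=> u v /andP[/andP[]]; have := bnd v; have := bnd (- v); lia.
- move=> u v Euv; have [vE|] := eqVneq v (- k.+2%:Z); last exact: step.
  (* Oddness of s reduces this height to k + 2. *)
  have Euv' : E (- u) (- v) by rewrite EN.
  have vmin : - v != - k.+2%:Z by lia.
  have [u' fu' Eu'] := step _ _ Euv' vmin.
  exists (- u'); last by rewrite -EN opprK.
  by apply: oppr_inj; rewrite -s_polyN -!rmorphN /= fu' opprD opprK.
rewrite /E /I; have := bnd x; have := bnd (- x); have := bnd y.
by have := bnd (- y); lia.
Qed.

(** The radius k - 2 comes from k = 2 modulo 3, where the plateau used is at k - 1 and k; for k = 1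
    modulo 3 it is at k and k + 1. *)
Lemma periodic_box k (x y : int) : (0 < k)%N ->
    `|x| <= (k - 2)%N%:Z -> `|y| <= (k - 2)%N%:Z ->
  periodic (henon (s_poly k.*2.+1)) (x%:~R, y%:~R).
Proof.
move=> k0 xk yk.
have : (k %% 3)%N = 0%N \/ (k %% 3)%N = 1%N \/ (k %% 3)%N = 2%N by lia.
case=> [k3|[k3|k3]].
- by apply: periodic_box_mod3_0 => //; lia.
- apply: (periodic_box_of_plateau k k (-1)); rewrite ?/wave //; try lia.
    by have := hexagonP (k%:Z + 3 * k%:Z) => /=; lia.
  by have := hexagonP (k%:Z + 1 + 3 * k%:Z) => /=; lia.
- apply: (periodic_box_of_plateau k (k%:Z - 1) 1); rewrite ?/wave //; try lia.
    by have := hexagonP (k%:Z - 1 + 3 * k%:Z) => /=; lia.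
  by have := hexagonP (k%:Z - 1 + 1 + 3 * k%:Z) => /=; lia.
Qed.

Theorem theorem1 (d : nat) (odd_d : odd d) (d_gt2 : (2 < d)%N) :
  (size (s_poly d) <= d.+1)%N /\
  exists S : seq (rat * rat),
    [/\ uniq S,
        (d%:Z - 4) ^+ 2 <= (size S)%:Z
      & forall P : rat * rat, P \in S -> periodic (henon (s_poly d)) P].
Proof.
have [k dE] : exists k, d = k.*2.+1.
  by exists d./2; rewrite -[LHS]odd_double_half odd_d.
rewrite {}dE in odd_d d_gt2 *; split; first exact: size_s_poly.
have k_gt0 : (0 < k)%N by lia.
pose b := (k - 2)%N.
pose r := [seq (i%:Z - b%:Z)%:~R : rat | i <- iota 0 b.*2.+1].
have in_r a : a \in r -> exists2 z : int, `|z| <= b%:Z & a = z%:~R.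
  case/mapP => i; rewrite mem_iota => ib ->.
  by exists (i%:Z - b%:Z) => //; lia.
exists [seq (x, y) | x <- r, y <- r]; split.
- have uniq_r : uniq r.
    rewrite map_inj_uniq ?iota_uniq // => i j /intr_inj /addIr.
    by case.
  by apply: allpairs_uniq => // -[? ?] [? ?].
- rewrite size_allpairs size_map size_iota.
  (* For d = 3 the truncated [b] is 0: the box is a single point, and (3 - 4)^2 = 1. *)
  have [k1|k2] := leqP k 1.
    have -> : k = 1%N by lia.
    by [].
  have -> : k.*2.+1%:Z - 4 = b.*2.+1%:Z by rewrite /b; lia.
  by rewrite expr2 PoszM.
- move=> _ /allpairsP[[p q] /= [/in_r[x xb ->] /in_r[y yb ->] ->]].
  exact: periodic_box.
Qed.
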